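(* Let $\mathcal{K},\mathcal{H}$ be complex Hilbert spaces. Assume that a positive linear map $\phi:\mathfrak{B}(\mathcal{K})\to\mathfrak{B}(\mathcal{H})$ fulfils the following conditions: (1) $\phi\in G_{\xi,x}\setminus F_{\xi,x}$ for some unit vectors $\xi\in\mathcal{K}$, $x\in\mathcal{H}$; (2) $\phi$ is extremal in the cone of positive maps from $\mathfrak{B}(\mathcal{K})$ to $\mathfrak{B}(\mathcal{H})$; (3) $\phi$ is locally completely positive. Then $\phi$ is of the form $\phi(X)=BXB^*$, $X\in\mathfrak{B}(\mathcal{K})$, for some bounded linear operator $B\in\mathfrak{B}(\mathcal{K},\mathcal{H})$.
   Context: $\mathfrak{B}(\mathcal{K})$ denotes the bounded operators on $\mathcal{K}$ and $\mathfrak{B}(\mathcal{K},\mathcal{H})$ the bounded operators from $\mathcal{K}$ to $\mathcal{H}$. Inner products are linear in the second variable, and $\xi\eta^*$ is the operator $\tau\mapsto\langle\eta,\tau\rangle\xi$. A linear map $\mathfrak{B}(\mathcal{K})\to\mathfrak{B}(\mathcal{H})$ is positive if it maps positive operators to positive operators; $\mathfrak{P}(\mathfrak{B}(\mathcal{K}),\mathcal{H})$ is the cone of all (bounded) positive maps, ordered by $\psi\leq\phi$ iff $\phi-\psi$ is positive. An element $\phi$ of this cone is extremal if $\{\lambda\phi:\lambda\geq0\}$ is a face, i.e. $0\leq\psi\leq\lambda\phi$ with $\lambda\ge 0$ implies that $\psi$ is a non-negative multiple of $\phi$. For unit vectors $\xi\in\mathcal{K}$, $x\in\mathcal{H}$: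 $G_{\xi,x}=\{\phi\in\mathfrak{P}(\mathfrak{B}(\mathcal{K}),\mathcal{H}):\ \phi(\xi\xi^* )=\lambda xx^*\text{ for some }\lambda\geq0\}$ and $F_{\xi,x}=\{\phi\in\mathfrak{P}(\mathfrak{B}(\mathcal{K}),\mathcal{H}):\ \phi(\xi\xi^* )x=0\}$. A positive map $\phi$ is locally completely positive if there is a constant $\gamma>0$ such that $(\gamma\phi)(X^*X)\geq(\gamma\phi)(X^* )(\gamma\phi)(X)$ for all $X\in\mathfrak{B}(\mathcal{K})$. *)

(* Defs.v *)
From HB Require Import structures.
From mathcomp Require Import all_boot all_order all_algebra.
From mathcomp Require Import complex ring lra.
From mathcomp Require Import all_classical all_reals all_analysis.

Set Implicit Arguments.
Unset Strict Implicit.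
Unset Printing Implicit Defensive.

Import Order.TTheory GRing.Theory Num.Theory.
Import numFieldNormedType.Exports.

Local Open Scope classical_set_scope.
Local Open Scope ring_scope.

(* The scalars are C := R[i]; norms are C-valued, and [0 <= z] on C means that
   z is a nonnegative real. Inner products are linear in the second variable
   and [_^*] on scalars is complex conjugation. *)
HB.mixin Record isHilbert (R : realType) V of CompleteNormedModule R[i] V := {
  inner : V -> V -> R[i];
  innerP : forall x, linear_for *%R (inner x);
  innerC : forall x y, inner x y = (inner y x)^*;
  innerxx : forall x, inner x x = `|x| ^+ 2
}.

#[short(type="hilbertType")]
HB.structure Definition Hilbert (R : realType) :=
  {V of CompleteNormedModule R[i] V & isHilbert R V}.

Section HilbertTheory.
Variables (R : realType) (H : hilbertType R).
Local Notation C := R[i].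
Implicit Types (x y z : H) (a : C).

Lemma innerDr x y z : inner x (y + z) = inner x y + inner x z.
Proof. by have := innerP x 1 y z; rewrite scale1r mul1r. Qed.

Lemma inner0r x : inner x 0 = 0.
Proof.
apply/eqP; have /eqP := innerDr x 0 0.
by rewrite addr0 -subr_eq0 opprD addNKr oppr_eq0.
Qed.

Lemma innerZr x a y : inner x (a *: y) = a * inner x y.
Proof. by have := innerP x a y 0; rewrite !addr0 inner0r addr0. Qed.

Lemma innerNr x y : inner x (- y) = - inner x y.
Proof. by rewrite -scaleN1r innerZr mulN1r. Qed.

Lemma innerBr x y z : inner x (y - z) = inner x y - inner x z.
Proof. by rewrite innerDr innerNr. Qed.

Lemma innerDl x y z : inner (x + y) z = inner x z + inner y z.
Proof. by rewrite innerC innerDr rmorphD/= -!innerC. Qed.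

Lemma innerZl x a y : inner (a *: x) y = a^* * inner x y.
Proof. by rewrite innerC innerZr rmorphM/= -innerC. Qed.

Lemma innerNl x y : inner (- x) y = - inner x y.
Proof. by rewrite innerC innerNr rmorphN/= -innerC. Qed.

Lemma innerBl x y z : inner (x - y) z = inner x z - inner y z.
Proof. by rewrite innerDl innerNl. Qed.

Lemma inner0l x : inner 0 x = 0.
Proof. by rewrite innerC inner0r conjC0. Qed.

Lemma inner_eq0 x : (forall y, inner y x = 0) -> x = 0.
Proof.
by move=> /(_ x)/eqP; rewrite innerxx sqrf_eq0 normr_eq0 => /eqP.
Qed.

Lemma CauchySchwarz_inner x y : `|inner x y| <= `|x| * `|y|.
Proof.
have [->|y0] := eqVneq y 0; first by rewrite inner0r normr0 mulr_ge0.
have yp : 0 < `|y| by rewrite normr_gt0.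
rewrite -(@ler_pXn2r _ 2) ?nnegrE ?mulr_ge0//.
set b := inner y x; have bC : inner x y = b^* by rewrite innerC.
have /= := exprn_ge0 2 (normr_ge0 (`|y| ^+ 2 *: x - b *: y)).
rewrite -innerxx innerBl !innerBr !innerZl !innerZr !innerxx -/b bC norm_conjC.
have -> : (`|y| ^+ 2)^* = `|y| ^+ 2 :> C by rewrite geC0_conj ?exprn_ge0.
have -> : `|y| ^+ 2 * (`|y| ^+ 2 * `|x| ^+ 2) - `|y| ^+ 2 * (b * b^*)
   - (b^* * (`|y| ^+ 2 * b) - b^* * (b * `|y| ^+ 2))
   = `|y| ^+ 2 * ((`|x| * `|y|) ^+ 2 - `|b| ^+ 2) by rewrite normCK; ring.
by rewrite pmulr_rge0 ?exprn_gt0// subr_ge0.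
Qed.

End HilbertTheory.

Section Riesz.
Variables (R : realType) (H : hilbertType R).
Local Notation C := R[i].
Variable (f : H -> C).
Hypothesis f_lin : linear_for *%R f.
Variable M : C.
Hypothesis f_bnd : forall x, `|f x| <= M * `|x|.

Let J (v : H) : C := `|v| ^+ 2 - (f v + (f v)^*).

Let f0 : f 0 = 0.
Proof.
have /eqP := f_lin (-1) 0 0.
by rewrite scaleN1r oppr0 addr0 mulN1r addNr => /eqP.
Qed.

Let J_real v : J v \is Num.real.
Proof.
apply/CrealP; rewrite /J rmorphB/= rmorphD/= conjCK geC0_conj ?exprn_ge0//.
by rewrite [(f v)^* + _]addrC.
Qed.

Let J_lb v : - `|M| ^+ 2 <= J v.
Proof.
have fv : `|f v| <= `|M| * `|v|.
  have p : 0 <= M * `|v| by apply: le_trans (f_bnd v).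
  by rewrite -[X in _ * X]normr_id -normrM ger0_norm.
have fv2 : f v + (f v)^* <= 2 * (`|M| * `|v|).
  have -> : f v + (f v)^* = 2 * 'Re (f v).
    by rewrite ReE mulrCA divff ?mulr1// pnatr_eq0.
  rewrite ler_pM2l ?ltr0n//; apply: le_trans fv.
  exact: (leif_Re_Creal _).1.
rewrite -subr_ge0 opprK.
apply: (@le_trans _ _ ((`|v| - `|M|) ^+ 2)).
  by rewrite real_exprn_even_ge0// rpredB// normr_real.
rewrite sqrrB lerD2r /J lerD2l lerN2 -mulr_natl.
by rewrite [`|v| * _]mulrC.
Qed.

Let J_min (v w : H) : w != 0 ->
  J (v - ((inner v w - f w)^* / `|w| ^+ 2) *: w)
  = J v - `|inner v w - f w| ^+ 2 / `|w| ^+ 2.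
Proof.
move=> w0; have nw : `|w| != 0 by rewrite normr_eq0.
rewrite normCK; set g := inner v w - f w; set t := g^* / _.
have tC : t^* = g / `|w| ^+ 2.
  by rewrite /t rmorphM/= conjCK fmorphV/= geC0_conj ?exprn_ge0.
have fB : f (v - t *: w) = f v - t * f w.
  by rewrite [v - _]addrC -scaleNr f_lin mulNr addrC.
rewrite /J -!innerxx innerBl !innerBr !innerZl !innerZr fB tC.
rewrite rmorphB/= rmorphM/= tC.
rewrite [inner w v]innerC -/g.
have -> : inner v w = g + f w by rewrite /g subrK.
rewrite rmorphD/= (innerxx w) /t; field.
exact: nw.
Qed.

Let approx (d : C) : 0 < d ->
  exists v, forall w, `|inner v w - f w| <= d * `|w|.
Proof.
move=> d0; have d2 : 0 < d ^+ 2 by rewrite exprn_gt0.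
have dR : (complex.Re (d ^+ 2))%:C%C = d ^+ 2 by rewrite RRe_real// gtr0_real.
pose E := range (fun v => complex.Re (J v)).
have JE v : (complex.Re (J v))%:C%C = J v by rewrite RRe_real.
have Mr : (complex.Re (- `|M| ^+ 2))%:C%C = - `|M| ^+ 2.
  by rewrite RRe_real// rpredN rpredX// normr_real.
have lbE : has_lbound E.
  exists (complex.Re (- `|M| ^+ 2)) => _ [v _ <-].
  by rewrite -lecR JE Mr.
have infE : has_inf E by split => //; exists (complex.Re (J 0)); exists 0.
have [|_ [v _ <-] vlt] := @inf_adherent R E (complex.Re (d ^+ 2)) _ infE.
  by rewrite -ltcR dR.
exists v => w; have [->|w0] := eqVneq w 0.
  by rewrite inner0r f0 subr0 !normr0 mulr0.
have nw : 0 < `|w| by rewrite normr_gt0.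
rewrite -(@ler_pXn2r _ 2) ?nnegrE ?mulr_ge0 ?(ltW d0)//.
rewrite exprMn -ler_pdivrMr ?exprn_gt0//.
have Einf : inf E <=
    complex.Re (J (v - ((inner v w - f w)^* / `|w| ^+ 2) *: w)).
  by apply: ge_inf => //; eexists.
move: vlt Einf; rewrite -ltcR -lecR !JE J_min// rmorphD/= dR => a b.
have := le_trans b (lerB (ltW a) (lexx (`|inner v w - f w| ^+ 2 / `|w| ^+ 2))).
by rewrite -addrA lerDl subr_ge0.
Qed.

Lemma riesz : exists v, forall w, f w = inner v w.
Proof.
pose B (d : C) := [set v : H | forall w, `|inner v w - f w| <= d * `|w|].
pose F := filter_from [set d : C | 0 < d] B.
have FF : ProperFilter F.
  apply: filter_from_proper; last first.
    by move=> d d0; have [v vP] := approx d0; exists v.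
  apply: filter_from_filter; first by exists 1 => /=.
  move=> d e /= d0 e0.
  have k0 : 0 < (d^-1 + e^-1)^-1 by rewrite invr_gt0 addr_gt0// invr_gt0.
  exists (d^-1 + e^-1)^-1 => // v vP; split => w; apply: (le_trans (vP w));
    rewrite ler_wpM2r// -[leRHS]invrK lef_pV2 ?posrE ?addr_gt0 ?invr_gt0//.
    by rewrite lerDl invr_ge0 ltW.
  by rewrite lerDr invr_ge0 ltW.
have BF d : 0 < d -> F (B d) by exists d.
have Fc : cvg F.
  apply: cauchy_cvg; apply/cauchy_ballP => e e0.
  have e4 : 0 < e / 4 by rewrite divr_gt0.
  exists (B (e / 4), B (e / 4)); first by split; exact: BF.
  move=> [u v] [/= uB vB]; rewrite -ball_normE /ball_/=.
  have [->|uv] := eqVneq u v; first by rewrite subrr normr0.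
  have n0 : 0 < `|u - v| by rewrite normr_gt0 subr_eq0.
  rewrite -(ltr_pM2r n0) -expr2 -innerxx innerBl.
  have -> : inner u (u - v) - inner v (u - v)
     = (inner u (u - v) - f (u - v)) - (inner v (u - v) - f (u - v)).
    by rewrite opprB addrA subrK.
  set z := _ - _; have : `|z| <= e / 4 * `|u - v| + e / 4 * `|u - v|.
    by apply: (le_trans (ler_normB _ _)); rewrite lerD.
  have zE : z = `|z|.
    rewrite ger0_norm// /z opprB addrA subrK -innerBl innerxx exprn_ge0//.
  rewrite -zE => /le_lt_trans; apply.
  rewrite -mulrDl ltr_pM2r//.
  have -> : e / 4 + e / 4 = e / 2 by field.
  by rewrite ltr_pdivrMr// ltr_pMr// ltr1n.
have /cvg_ex[v /= vP] := Fc.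
exists v => w; apply/eqP; rewrite eq_sym -subr_eq0.
have small d : 0 < d -> `|inner v w - f w| <= (d + d) * `|w|.
  move=> d0; have : F (ball v d) by apply: vP; exact: nbhsx_ballx.
  rewrite -ball_normE => vu.
  have [u [uv uB]] := filter_ex (filterI vu (BF _ d0)).
  have -> : inner v w - f w = inner (v - u) w + (inner u w - f w).
    by rewrite innerBl addrA subrK.
  rewrite (le_trans (ler_normD _ _))// mulrDl lerD//.
  by rewrite (le_trans (CauchySchwarz_inner _ _))// ler_wpM2r// ltW.
have [->|w0] := eqVneq w 0; first by rewrite inner0r f0 subr0.
have nw : 0 < `|w| by rewrite normr_gt0.
rewrite -normr_eq0; apply: contraT; rewrite -normr_gt0 normr_id => X0.
have := small (`|inner v w - f w| / (4 * `|w|)).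
rewrite divr_gt0 ?mulr_gt0// => /(_ isT).
have -> : (`|inner v w - f w| / (4 * `|w|) + `|inner v w - f w| / (4 * `|w|))
   * `|w| = `|inner v w - f w| * 2^-1 by field; exact: lt0r_neq0.
by rewrite -[leLHS]mulr1 ler_pM2l// invf_ge1 // lern1.
Qed.

End Riesz.

Section BoundedOp.
Variables (R : realType) (K H : hilbertType R).

Definition bounded_op : {pred (K -> H)} :=
  [pred f : K -> H |
    `[< linear f /\ exists M : R[i], forall x, `|f x| <= M * `|x| >]].

Record boundedOp := BoundedOp { op_fun :> K -> H; _ : op_fun \in bounded_op }.

HB.instance Definition _ := [isSub for op_fun].
HB.instance Definition _ := [Choice of boundedOp by <:].

Lemma bounded_opP (f : K -> H) : linear f ->
  (exists M : R[i], forall x, `|f x| <= M * `|x|) -> f \in bounded_op.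
Proof. by move=> lf bf; apply/asboolP. Qed.

Lemma bounded_op_submod : submod_closed bounded_op.
Proof.
split; first apply: bounded_opP.
- by move=> a x y; rewrite scaler0 addr0.
- by exists 0 => x; rewrite mul0r normr0.
move=> a f g /asboolP[lf [M fM]] /asboolP[lg [N gN]]; apply: bounded_opP.
- by move=> b x y; rewrite /= -[LHS]/(a *: f _ + g _) lf lg
    -[RHS]/(b *: (a *: f x + g x) + (a *: f y + g y));
    rewrite !scalerDr !scalerA mulrC addrACA.
- exists (`|a| * M + N) => x; apply: (le_trans (ler_normD _ _)).
  rewrite mulrDl lerD// -[X in `|X|]/(a *: f x) normrZ -mulrA.
  exact: ler_wpM2l.
Qed.

HB.instance Definition _ :=
  GRing.isSubmodClosed.Build _ _ bounded_op bounded_op_submod.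
HB.instance Definition _ := [SubChoice_isSubLmodule of boundedOp by <:].

Lemma op_linear (X : boundedOp) : linear X.
Proof. by case: X => f /= /asboolP[]. Qed.

HB.instance Definition _ (X : boundedOp) :=
  GRing.isLinear.Build R[i] K H _ X (op_linear X).

Lemma op_bounded (X : boundedOp) :
  exists M : R[i], forall x, `|X x| <= M * `|x|.
Proof. by case: X => f /= /asboolP[]. Qed.

Lemma opDE (X Y : boundedOp) x : (X + Y) x = X x + Y x. Proof. by []. Qed.
Lemma opBE (X Y : boundedOp) x : (X - Y) x = X x - Y x. Proof. by []. Qed.
Lemma opZE a (X : boundedOp) x : (a *: X) x = a *: X x. Proof. by []. Qed.

End BoundedOp.

Section Composition.
Variables (R : realType) (K H L : hilbertType R).

Lemma op_comp_subproof (X : boundedOp H L) (Y : boundedOp K H) :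
  X \o Y \in @bounded_op R K L.
Proof.
have [M XM] := op_bounded X; have [N YN] := op_bounded Y.
apply: bounded_opP; first by move=> a x y /=; rewrite !linearP.
exists (`|M| * N) => x /=; rewrite -mulrA.
apply: (@le_trans _ _ (`|M| * `|Y x|)); last by rewrite ler_wpM2l.
have p : 0 <= M * `|Y x| by apply: le_trans (XM _).
by rewrite -[X in _ * X]normr_id -normrM ger0_norm.
Qed.

Definition op_comp (X : boundedOp H L) (Y : boundedOp K H) : boundedOp K L :=
  BoundedOp (op_comp_subproof X Y).

End Composition.

Section RankOne.
Variables (R : realType) (K H : hilbertType R).

Lemma rank1_subproof (xi : H) (eta : K) :
  (fun tau => inner eta tau *: xi) \in @bounded_op R K H.
Proof.
apply: bounded_opP.
  by move=> a x y /=; rewrite innerP scalerDl scalerA.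
exists (`|eta| * `|xi|) => x; rewrite normrZ mulrAC ler_wpM2r//.
exact: CauchySchwarz_inner.
Qed.

(* xi eta^* *)
Definition rank1 (xi : H) (eta : K) : boundedOp K H :=
  BoundedOp (rank1_subproof xi eta).

End RankOne.

Section Adjoint.
Variables (R : realType) (K H : hilbertType R) (X : boundedOp K H).

Lemma adjoint_ex :
  exists Y : boundedOp H K, forall x y, inner (Y y) x = inner y (X x).
Proof.
have [M XM] := op_bounded X.
have /choice[g gP] (y : H) :
    exists v : K, forall x, inner y (X x) = inner v x.
  apply: (@riesz R K (fun x => inner y (X x)) _ (`|y| * M)).
    by move=> a u v; rewrite linearP innerP.
  move=> x; apply: (le_trans (CauchySchwarz_inner _ _)).
  by rewrite -mulrA ler_wpM2l.
have gB : g \in @bounded_op R H K.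
  apply: bounded_opP.
    move=> a u v; apply/eqP; rewrite -subr_eq0; apply/eqP.
    apply: inner_eq0 => x; rewrite innerC innerBl innerDl innerZl -!gP.
    by rewrite innerDl innerZl subrr conjC0.
  exists `|M| => y; have [->|g0] := eqVneq (g y) 0.
    by rewrite normr0 mulr_ge0.
  have p : 0 < `|g y| by rewrite normr_gt0.
  rewrite -(ler_pM2r p) -expr2 -innerxx -gP.
  have -> : inner y (X (g y)) = `|inner y (X (g y))|.
    by rewrite gP innerxx ger0_norm// exprn_ge0.
  apply: (le_trans (CauchySchwarz_inner _ _)).
  rewrite [`|M| * _]mulrC -mulrA ler_wpM2l//.
  have q : 0 <= M * `|g y| by apply: le_trans (XM _).
  by rewrite -[X in _ * X]normr_id -normrM ger0_norm.
by exists (BoundedOp gB) => x y; rewrite gP.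
Qed.

Definition adjoint : boundedOp H K := projT1 (cid adjoint_ex).

Lemma adjointP x y : inner (adjoint y) x = inner y (X x).
Proof. by rewrite /adjoint; case: cid. Qed.

End Adjoint.

Section OperatorOrder.
Variables (R : realType) (H : hilbertType R).
Implicit Types X Y : boundedOp H H.

Definition op_pos X := forall x, 0 <= inner x (X x).

Definition op_le X Y := op_pos (Y - X).

(* ||X|| <= c for the operator norm *)
Definition opnorm_le X (c : R[i]) :=
  0 <= c /\ forall x, `|X x| <= c * `|x|.

End OperatorOrder.

Section PositiveMaps.
Variables (R : realType) (K H : hilbertType R).
Local Notation C := R[i].
Local Notation BK := (boundedOp K K).
Local Notation BH := (boundedOp H H).

Definition map_pos (phi : BK -> BH) := forall X, op_pos X -> op_pos (phi X).

Definition map_bounded (phi : BK -> BH) := exists M : C,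
  forall X c, opnorm_le X c -> opnorm_le (phi X) (M * c).

(* Boundedness is automatic for a positive linear map on bounded operators. *)
Definition pos_cone : set {linear BK -> BH} :=
  [set phi : {linear BK -> BH} | map_pos phi /\ map_bounded phi].

Definition map_le (psi phi : BK -> BH) := map_pos (phi \- psi).

Definition extremal (phi : {linear BK -> BH}) :=
  pos_cone phi /\
  forall (psi : {linear BK -> BH}) (lambda : C), 0 <= lambda ->
    pos_cone psi -> map_le psi (lambda \*: phi) ->
    exists mu : C, 0 <= mu /\ forall X, psi X = mu *: phi X.

Definition face_G (xi : K) (x : H) : set {linear BK -> BH} :=
  pos_cone `&` [set phi : {linear BK -> BH} | exists lambda : C,
    0 <= lambda /\ phi (rank1 xi xi) = lambda *: rank1 x x].

Definition face_F (xi : K) (x : H) : set {linear BK -> BH} :=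
  pos_cone `&` [set phi : {linear BK -> BH} | phi (rank1 xi xi) x = 0].

Definition locally_cp (phi : BK -> BH) :=
  map_pos phi /\
  exists gamma : C, 0 < gamma /\ forall X,
    op_le (op_comp (gamma *: phi (adjoint X)) (gamma *: phi X))
          (gamma *: phi (op_comp (adjoint X) X)).

End PositiveMaps.

(* Main.v *)
Require Import Defs.
From HB Require Import structures.
From mathcomp Require Import all_boot all_order all_algebra.
From mathcomp Require Import complex ring.
From mathcomp Require Import all_classical all_reals all_analysis.

(** By extremality it is enough to find a nonzero [psi], of the form
    [X |-> B X B^*], below a multiple of [phi]: then [psi] is a multiple
    [mu phi] with [mu > 0], and [mu^(-1/2) B] represents [phi]. The candidate is
    [B eta := phi (eta xi^* ) x]. It is nonzero since [B xi = phi (xi xi^* ) x],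
    which does not vanish because [phi] is outside [F_(xi, x)].

    The domination is a statement about rank one operators. As
    [(xi zeta^* )^* (xi zeta^* ) = zeta zeta^*] for a unit vector [xi], local
    complete positivity at [xi zeta^*] together with
    [phi (X^* ) = phi (X)^*] ([map_pos_adjoint]) gives
    [<y, phi (zeta zeta^* ) y> >= gamma |phi (xi zeta^* ) y|^2
                               >= gamma |<x, phi (xi zeta^* ) y>|^2
                                = gamma |<B zeta, y>|^2]
    ([lcp_rank1_ge]). To reach a general [X >= 0], put [v := B^* y] and
    [zeta := X v]. The Cauchy-Schwarz inequality for the form [<., X .>] says
    that [zeta zeta^* <= <v, X v> X] ([rank1_le_op_pos]), whence
    [<v, X v> <y, phi (X) y> >= gamma |<B X v, y>|^2 = gamma <v, X v>^2],
    and dividing by [<v, X v> = <y, B X B^* y>] yields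
    [gamma B X B^* <= phi (X)]. Choosing [zeta] in the range of [X] itself
    makes a square root of [X] superfluous. *)

Import Order.TTheory GRing.Theory Num.Theory.

Local Open Scope classical_set_scope.
Local Open Scope ring_scope.

(** * Adjoints and positive operators *)

Lemma op_ext {R : realType} {K H : hilbertType R} (X Y : boundedOp K H) :
  X =1 Y -> X = Y.
Proof. by move=> XY; apply/val_inj/funext. Qed.

Lemma op_compE {R : realType} {K H L : hilbertType R} (X : boundedOp H L)
    (Y : boundedOp K H) x :
  op_comp X Y x = X (Y x).
Proof. by []. Qed.

Lemma inner_injl {R : realType} {H : hilbertType R} (u v : H) :
  (forall w, inner u w = inner v w) -> u = v.
Proof.
move=> uv; apply/eqP; rewrite -subr_eq0; apply/eqP/inner_eq0 => w.
by rewrite innerC innerBl uv subrr conjC0.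
Qed.

Lemma adjointPr {R : realType} {K H : hilbertType R} (X : boundedOp K H) x y :
  inner x (adjoint X y) = inner (X x) y.
Proof. by rewrite innerC adjointP -innerC. Qed.

Lemma adjoint_unique {R : realType} {K H : hilbertType R}
    (X : boundedOp K H) (Y : boundedOp H K) :
  (forall x y, inner (Y y) x = inner y (X x)) -> adjoint X = Y.
Proof.
by move=> XY; apply: op_ext => y; apply: inner_injl => x; rewrite adjointP XY.
Qed.

Lemma adjointZ {R : realType} {K H : hilbertType R} (a : R[i])
    (X : boundedOp K H) :
  adjoint (a *: X) = a^* *: adjoint X.
Proof.
by apply: adjoint_unique => x y; rewrite !opZE innerZl innerZr conjCK adjointP.
Qed.

Lemma adjoint_rank1 {R : realType} {K H : hilbertType R} (u : H) (v : K) :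
  adjoint (rank1 u v) = rank1 v u.
Proof.
apply: adjoint_unique => x y; rewrite /= innerZl innerZr -innerC.
by rewrite mulrC.
Qed.

(** Complex polarization: the cross terms at [u + v] show that
    [<u, T v> + <v, T u>] vanishes, those at [u + i v] that the difference
    [<u, T v> - <v, T u>] does. *)
Lemma op_quad_eq0 {R : realType} {H : hilbertType R} (T : boundedOp H H) :
  (forall u, inner u (T u) = 0) -> T = 0.
Proof.
move=> T0.
have cross u v : inner u (T v) + inner v (T u) = 0.
  have := T0 (u + v); rewrite linearD innerDl !innerDr !T0.
  by rewrite add0r addr0.
apply: op_ext => v; apply: inner_eq0 => u.
have := cross u ('i *: v).
rewrite linearZ innerZr innerZl conjCi mulNr -mulrBr => /eqP.
rewrite mulf_eq0 (negbTE (neq0Ci _)) /= subr_eq0 => /eqP E.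
have /eqP := cross u v; rewrite -E -mulr2n mulrn_eq0 /=.
by move/eqP.
Qed.

Lemma op_eq_quad {R : realType} {H : hilbertType R} (X Y : boundedOp H H) :
  (forall u, inner u (X u) = inner u (Y u)) -> X = Y.
Proof.
move=> XY; apply/eqP; rewrite -subr_eq0; apply/eqP/op_quad_eq0 => u.
by rewrite opBE innerBr XY subrr.
Qed.

Lemma op_pos_adjoint {R : realType} {H : hilbertType R} (X : boundedOp H H) :
  op_pos X -> adjoint X = X.
Proof.
move=> X0; apply: op_eq_quad => u.
by rewrite adjointPr innerC geC0_conj.
Qed.

Lemma op_pos_gram {R : realType} {K H : hilbertType R} (X : boundedOp K H) :
  op_pos (op_comp (adjoint X) X).
Proof. by move=> u /=; rewrite adjointPr innerxx exprn_ge0. Qed.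

(** The Cauchy-Schwarz inequality for the semi-inner product [<., X .>],
    read as an operator inequality. *)
Lemma rank1_le_op_pos {R : realType} {H : hilbertType R} {X : boundedOp H H}
    (v : H) :
  op_pos X -> op_le (rank1 (X v) (X v)) (inner v (X v) *: X).
Proof.
move=> X0 w; have Xsym a b : inner (X a) b = inner a (X b).
  by rewrite -adjointPr op_pos_adjoint.
rewrite opBE opZE innerBr /= !innerZr subr_ge0.
set p := inner v (X v); set q := inner w (X w); set b := inner (X v) w.
have p0 : 0 <= p := X0 v.
have q0 : 0 <= q := X0 w.
have bw : inner w (X v) = b^* by rewrite -innerC.
have bv : inner v (X w) = b by rewrite -Xsym.
rewrite bw.
(* the form at [s w - t v] *)
have form (s t : R[i]) :
    0 <= s^* * (s * q) - s^* * (t * b^*) - (t^* * (s * b) - t^* * (t * p)).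
  have := X0 (s *: w - t *: v).
  rewrite linearB /= [X (s *: _)]linearZ [X (t *: _)]linearZ /=.
  rewrite innerBl !innerBr !innerZl !innerZr.
  by rewrite bw bv.
have [pE|pN] := eqVneq p 0; last first.
  have := form p b; rewrite geC0_conj //.
  have -> : p * (p * q) - p * (b * b^*) - (b^* * (p * b) - b^* * (b * p))
     = p * (p * q - b * b^*) by ring.
  by rewrite pmulr_rge0 ?lt_def ?pN // subr_ge0 mulrC.
have [->|bN] := eqVneq b 0; first by rewrite conjC0 mul0r pE mul0r.
(* the form is affine in the scalar when [p = 0], so a nonzero slope [b] would
   make it negative somewhere *)
have bcN : b^* != 0 by rewrite conjC_eq0.
have q1C : (q + 1)^* = q + 1 by rewrite geC0_conj ?addr_ge0.
have := form 1 ((q + 1) / b^*).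
rewrite pE conjC1 rmorphM fmorphV /= conjCK q1C.
have -> : 1 * (1 * q) - 1 * ((q + 1) / b^* * b^*) -
    ((q + 1) / b * (1 * b) - (q + 1) / b * ((q + 1) / b^* * 0)) = - (q + 2).
  by field; rewrite bN bcN.
by rewrite oppr_ge0 => /le_gtF; rewrite ltr_wpDl.
Qed.

(** * Positive maps *)

(** Both [X^*] and [X] enter the positive operator [(1 + X)^* (1 + X)] with
    coefficient one, so [<u, phi (X^* ) u> + <u, phi (X) u>] is real. The same
    for [i X] shows that the two summands are conjugate to each other. *)
Lemma map_pos_adjoint {R : realType} {K H : hilbertType R}
    {phi : {linear boundedOp K K -> boundedOp H H}} (X : boundedOp K K) :
  map_pos phi -> phi (adjoint X) = adjoint (phi X).
Proof.
move=> phi0; apply: op_eq_quad => u; rewrite adjointPr.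
have id_bounded : idfun \in @bounded_op R K K.
  by apply: bounded_opP => //; exists 1 => v; rewrite mul1r.
pose one := BoundedOp id_bounded.
pose q Y := inner u (phi Y u).
have qD Y Z : q (Y + Z) = q Y + q Z by rewrite /q linearD opDE innerDr.
have qZ a Y : q (a *: Y) = a * q Y by rewrite /q linearZ opZE innerZr.
have q_real Y : op_pos Y -> (q Y)^* = q Y.
  by move=> Y0; apply/geC0_conj/phi0.
have sum_real Y : (q Y + q (adjoint Y))^* = q Y + q (adjoint Y).
  have pos1 : op_pos one by move=> v; rewrite innerxx exprn_ge0.
  have posG := op_pos_gram Y.
  have pos : op_pos (Y + adjoint Y + (one + op_comp (adjoint Y) Y)).
    move=> v; have := exprn_ge0 2 (normr_ge0 (v + Y v)).
    rewrite -innerxx !opDE /= !innerDr !innerDl !adjointPr.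
    by congr (0 <= _); ring.
  have := q_real _ pos; rewrite !qD !rmorphD /= (q_real _ pos1).
  by rewrite (q_real _ posG) => /addIr.
have s1 := sum_real X; have s2 := sum_real ('i *: X).
move: s1 s2; rewrite adjointZ !qZ !rmorphD !rmorphM /= conjCi rmorphN /= conjCi.
rewrite -/(q X) -/(q (adjoint X)) opprK [inner (phi X u) u]innerC -/(q X).
move: (q X) (q (adjoint X)) => a b s1 s2.
have : 'i * (b - a^* + (b - a^*)) = 0 :> R[i].
  have -> : 'i * (b - a^* + (b - a^*)) =
    'i * (a + b - (a^* + b^*)) + (- 'i * a^* + 'i * b^* - ('i * a + - 'i * b)).
    by ring.
  by rewrite s1 s2 !subrr mulr0 addr0.
move/eqP; rewrite mulf_eq0 (negbTE (neq0Ci _)) /= -mulr2n mulrn_eq0 /=.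
by rewrite subr_eq0 => /eqP.
Qed.

(** The unscaled form of local complete positivity: one factor [gamma] cancels
    and [phi (X^* ) phi (X)] is the Gram operator of [phi (X)]. *)
Lemma lcp_ge {R : realType} {K H : hilbertType R}
    {phi : {linear boundedOp K K -> boundedOp H H}} :
  locally_cp phi -> exists gamma : R[i], 0 < gamma /\
    forall (X : boundedOp K K) y,
      gamma * `|phi X y| ^+ 2 <= inner y (phi (op_comp (adjoint X) X) y).
Proof.
move=> [phi0 [gamma [g0 lcp]]]; exists gamma; split=> // X y.
have := lcp X y; rewrite opBE innerBr op_compE !opZE linearZ !innerZr.
rewrite (map_pos_adjoint _ phi0) adjointPr innerxx -mulrBr.
by rewrite pmulr_rge0 // subr_ge0.
Qed.

(** * The operator implementing the map *)

Section Implementation.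
Context {R : realType} {K H : hilbertType R}.
Context {phi : {linear boundedOp K K -> boundedOp H H}}.
Hypotheses (phi_pos : map_pos phi) (phi_bounded : map_bounded phi).
Variables (xi : K) (x : H).

Lemma slice_subproof : (fun eta => phi (rank1 eta xi) x) \in @bounded_op R K H.
Proof.
apply: bounded_opP.
  move=> a u v /=.
  have -> : rank1 (a *: u + v) xi = a *: rank1 u xi + rank1 v xi.
    apply: op_ext => t; rewrite opDE opZE /= scalerDr.
    by rewrite !scalerA [a * _]mulrC.
  by rewrite linearP.
have [M phiM] := phi_bounded.
exists (M * `|xi| * `|x|) => eta.
have [|_] := phiM (rank1 eta xi) (`|eta| * `|xi|).
  split=> [|t /=]; first exact: mulr_ge0.
  rewrite normrZ mulrC -mulrA ler_wpM2l //.
  exact: CauchySchwarz_inner.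
by move/(_ x); congr (_ <= _); ring.
Qed.

(** The operator [eta |-> phi (eta xi^* ) x]. If [phi (X) = C X C^*], it is the
    multiple of [C] by the scalar [<C xi, x>]. *)
Definition slice : boundedOp K H := BoundedOp slice_subproof.

Hypotheses (xi1 : `|xi| = 1) (x1 : `|x| = 1).

(** Local complete positivity, tested on [xi zeta^*], whose Gram operator is
    [zeta zeta^*]; only the component along [x] is kept on the left. *)
Lemma lcp_rank1_ge {gamma : R[i]} :
  0 <= gamma ->
  (forall (X : boundedOp K K) y,
    gamma * `|phi X y| ^+ 2 <= inner y (phi (op_comp (adjoint X) X) y)) ->
  forall zeta y,
    gamma * `|inner (slice zeta) y| ^+ 2 <= inner y (phi (rank1 zeta zeta) y).
Proof.
move=> g0 lcp zeta y; have := lcp (rank1 xi zeta) y.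
have -> : op_comp (adjoint (rank1 xi zeta)) (rank1 xi zeta) = rank1 zeta zeta.
  apply: op_ext => t; rewrite adjoint_rank1 /= innerZr innerxx xi1.
  by rewrite expr1n mulr1.
apply: le_trans; rewrite ler_wpM2l // lerXn2r ?nnegrE //.
rewrite /= -(adjoint_rank1 xi zeta) map_pos_adjoint // adjointP.
by rewrite (le_trans (CauchySchwarz_inner _ _)) // x1 mul1r.
Qed.

(** For [v := slice^* y] and [zeta := X v], the rank one bound and
    [zeta zeta^* <= <v, X v> X] combine to the claimed inequality multiplied by
    [<v, X v>]. *)
Lemma lcp_slice_ge {gamma : R[i]} :
  0 <= gamma ->
  (forall (X : boundedOp K K) y,
    gamma * `|phi X y| ^+ 2 <= inner y (phi (op_comp (adjoint X) X) y)) ->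
  forall (X : boundedOp K K) y, op_pos X ->
    gamma * inner (adjoint slice y) (X (adjoint slice y))
      <= inner y (phi X y).
Proof.
move=> g0 lcp X y X0; set v := adjoint slice y; set p := inner v (X v).
have p0 : 0 <= p := X0 v.
have [->|pN] := eqVneq p 0; first by rewrite mulr0; exact: phi_pos.
have pp : 0 < p by rewrite lt_def pN.
have := phi_pos _ (rank1_le_op_pos v X0) y.
rewrite linearB linearZ opBE opZE innerBr innerZr subr_ge0 => le1.
have := le_trans (lcp_rank1_ge g0 lcp (X v) y) le1.
rewrite -adjointPr -/v innerC norm_conjC -/p ger0_norm //.
by rewrite expr2 mulrCA ler_pM2l.
Qed.

End Implementation.

Section Conjugation.
Context {R : realType} {K H : hilbertType R} (B : boundedOp K H).

Definition conj_map (X : boundedOp K K) : boundedOp H H :=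
  op_comp (op_comp B X) (adjoint B).

Lemma conj_map_linear : linear conj_map.
Proof. by move=> a X Y; apply: op_ext => y; rewrite opDE opZE /= linearP. Qed.

HB.instance Definition _ := GRing.isLinear.Build R[i] (boundedOp K K)
  (boundedOp H H) _ conj_map conj_map_linear.

Lemma inner_conj_map X y :
  inner y (conj_map X y) = inner (adjoint B y) (X (adjoint B y)).
Proof. by rewrite adjointP. Qed.

Lemma conj_map_pos_cone : pos_cone conj_map.
Proof.
split=> [X X0 y|]; first by rewrite inner_conj_map.
have [M BM] := op_bounded B; have [N BN] := op_bounded (adjoint B).
have bnd (L L' : hilbertType R) (T : boundedOp L L') (c : R[i]) :
    (forall t, `|T t| <= c * `|t|) -> forall t, `|T t| <= `|c| * `|t|.
  move=> Tc t; have p : 0 <= c * `|t| by apply: le_trans (Tc t).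
  by rewrite -[X in _ * X]normr_id -normrM ger0_norm.
exists (`|M| * `|N|) => X c [c0 Xc]; split; first by rewrite !mulr_ge0.
move=> y /=; apply: (le_trans (bnd _ _ _ _ BM _)).
rewrite -!mulrA ler_wpM2l //; apply: (le_trans (Xc _)).
by rewrite mulrCA ler_wpM2l //; exact: bnd.
Qed.

End Conjugation.

Lemma conj_mapZ {R : realType} {K H : hilbertType R} (a : R[i])
    (B : boundedOp K H) (X : boundedOp K K) :
  conj_map (a *: B) X = (a * a^*) *: conj_map B X.
Proof.
apply: op_ext => y.
rewrite /conj_map adjointZ opZE !op_compE !opZE.
by rewrite [X _]linearZ [B _]linearZ scalerA.
Qed.

(** The image of [xi xi^*] is the rank one operator [(B xi) (B xi)^*]. *)
Lemma conj_map_rank1_neq0 {R : realType} {K H : hilbertType R}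
    (B : boundedOp K H) (xi : K) :
  B xi != 0 -> conj_map B (rank1 xi xi) != 0.
Proof.
move=> BN; apply/eqP => /(congr1 (fun T : boundedOp H H => T (B xi))).
rewrite /= linearZ /= adjointPr innerxx => /eqP.
by rewrite scaler_eq0 expf_eq0 /= normr_eq0 (negbTE BN).
Qed.

Theorem theorem5p8 (R : realType) (K H : hilbertType R)
    (phi : {linear boundedOp K K -> boundedOp H H})
    (phi_pos : map_pos phi)
    (phi_GF : exists (xi : K) (x : H),
       [/\ `|xi| = 1, `|x| = 1 & (face_G xi x `\` face_F xi x) phi])
    (phi_extremal : extremal phi)
    (phi_lcp : locally_cp phi) :
  exists B : boundedOp K H,
    forall X : boundedOp K K, phi X = op_comp (op_comp B X) (adjoint B).
Proof.
have [xi [x [xi1 x1 [_ phiF]]]] := phi_GF.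
have [phi_cone ext] := phi_extremal; have [_ phi_bnd] := phi_cone.
have [gamma [g0 lcp]] := lcp_ge phi_lcp.
pose B := slice phi_bnd xi x.
(* [B xi] is [phi (xi xi^* ) x] *)
have BN : B xi != 0 by apply/eqP => Bxi; apply: phiF.
have [] := ext (conj_map B) gamma^-1 _ (conj_map_pos_cone B).
- by rewrite invr_ge0 ltW.
- move=> X X0 y.
  have := lcp_slice_ge phi_pos phi_bnd _ _ xi1 x1 (ltW g0) lcp _ y X0.
  rewrite -inner_conj_map -ler_pdivlMl // => le.
  by rewrite opBE opZE innerBr innerZr subr_ge0.
move=> mu [mu0 muE].
have muN : mu != 0.
  apply: (contraNneq _ (conj_map_rank1_neq0 B xi BN)) => mu_eq0; apply/eqP.
  by rewrite muE mu_eq0 scale0r.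
exists (sqrtC mu^-1 *: B) => X; rewrite -/(conj_map _ X) conj_mapZ.
rewrite geC0_conj ?sqrtC_ge0 ?invr_ge0 // -expr2 sqrtCK.
by rewrite muE scalerA mulVf ?scale1r.
Qed.
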